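(* Let $T$ be an injective half-centered bounded operator on a complex Hilbert space $\mathcal{H}$ such that $\bigvee_{k=0}^{\infty}T^{k}\mathcal{M}_{\mathcal{E}}=\mathcal{H}$ and $\dim (T\mathcal{H})^{\bot}=1$. Then at least one of the following two possibilities holds (they are not mutually exclusive). (1) There is an orthonormal basis $\{x_{k}:k\in\mathbb{N}\}$ of $\mathcal{H}$ consisting of common eigenvectors for the operators $T^{*k}T^{k}$, $k\in\mathbb{N}$, such that with respect to this basis either $T$ is a weighted shift, or there are a weighted shift $J$, an $n\in\mathbb{N}$ and an $a\in\mathbb{C}$ such that $$T=J+a\,(x_{0}\otimes x_{n}^{*}).$$ (2) There are constants $a,b,c,d\in\mathbb{R}$, not all zero, and $k,n\in\mathbb{N}^{+}$ such that $$aI+bT^{*k}T^{k}+cT^{*n}T^{n}+dT^{*(k+n)}T^{k+n}=0. \qquad (\ast)$$ Moreover, if $\dim\mathcal{M}_{\mathcal{E}}\geq 3$, then $(\ast)$ holds (for some $a,b,c,d\in\mathbb{R}$ and $k,n\in\mathbb{N}^{+}$) with $a\neq 0$, and the range of $T$ is closed.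
   Context: $\mathbb{N}=\{0,1,2,\dots\}$ and $\mathbb{N}^{+}=\{1,2,\dots\}$. A bounded operator $T$ on a Hilbert space is half-centered if the operators $T^{*}T, T^{*2}T^{2}, T^{*3}T^{3},\dots$ mutually commute. $\mathcal{E}:=\ker T^{*}=(T\mathcal{H})^{\bot}$. $\mathcal{M}_{\mathcal{E}}$ is the smallest closed subspace of $\mathcal{H}$ that contains $\mathcal{E}$ and is invariant under all the operators $T^{*k}T^{k}$, $k\in\mathbb{N}$. $\bigvee$ denotes the closed linear span. An operator $J$ is a weighted shift with respect to an orthonormal basis $\{x_k:k\in\mathbb{N}\}$ if $Jx_k=a_kx_{k+1}$ for all $k$, for some scalars $a_k\in\mathbb{C}$. $x_{0}\otimes x_{n}^{*}$ is the operator $x\mapsto\langle x,x_{n}\rangle x_{0}$. *)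

(* Defs.v *)
From HB Require Import structures.
From mathcomp Require Import all_boot all_order all_algebra.
From mathcomp Require Import complex.
From mathcomp Require Import boolp classical_sets functions reals topology
  normedtype.

Set Implicit Arguments.
Unset Strict Implicit.
Unset Printing Implicit Defensive.

Import Order.TTheory GRing.Theory Num.Theory.
Import numFieldNormedType.Exports.

Local Open Scope classical_set_scope.
Local Open Scope ring_scope.
Local Open Scope complex_scope.

(* A complex Hilbert space is given by H : completeNormedModType R[i] and an
   inner product dot : {dot H for Num.conj}, linear in its first argument and
   conjugate-linear in the second, such that dot x x = `|x| ^+ 2. *)

Section Subspaces.
Context {R : realType} {H : completeNormedModType R[i]}.
Implicit Types V A : set H.

Definition is_subspace V : Prop :=
  V 0 /\ forall (a : R[i]) x y, V x -> V y -> V (a *: x + y).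

Definition linear_span A : set H := smallest is_subspace A.

Definition closed_span A : set H := closure (linear_span A).

Definition lin_indep (n : nat) (v : 'I_n -> H) : Prop :=
  forall c : 'I_n -> R[i], \sum_(i < n) c i *: v i = 0 -> forall i, c i = 0.

Definition has_dim (n : nat) V : Prop :=
  exists v : 'I_n -> H, lin_indep v /\
    V = [set x | exists c : 'I_n -> R[i], x = \sum_(i < n) c i *: v i].

(* n <= dim V, where dim V may be infinite *)
Definition dim_ge (n : nat) V : Prop :=
  exists v : 'I_n -> H, (forall i, V (v i)) /\ lin_indep v.

End Subspaces.

Section Operators.
Context {R : realType} {H : completeNormedModType R[i]}.
Variable dot : {dot H for (@Num.conj R[i])}.
Implicit Types (T : {linear H -> H}) (x : nat -> H).

Definition bounded_operator T : Prop := bounded_near T (nbhs (0 : H)).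

(* adjoint T y is the vector z with <T x, y> = <x, z> for all x; for bounded T
   it exists by the Riesz representation theorem, and it is unique because dot
   is definite. *)
Definition adjoint T : H -> H :=
  fun y => xget 0 [set z | forall u, dot (T u) y = dot u z].

Definition adjpow T (k : nat) : H -> H :=
  fun y => iter k (adjoint T) (iter k T y).

Definition half_centered T : Prop :=
  forall m n : nat, (0 < m)%N -> (0 < n)%N ->
    adjpow T m \o adjpow T n = adjpow T n \o adjpow T m.

Definition orthocompl (A : set H) : set H :=
  [set y | forall u, A u -> dot u y = 0].

Definition ker_adjoint T : set H := [set y | adjoint T y = 0].

Definition M_E T : set H :=
  smallest [set V | [/\ is_subspace V, closed V &
                      forall k u, V u -> V (adjpow T k u)]]
           (ker_adjoint T).

Definition orthonormal_basis x : Prop :=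
  (forall i j : nat, dot (x i) (x j) = (i == j)%:R) /\
  closed_span (range x) = setT.

Definition common_eigenvectors T x : Prop :=
  forall k j : nat, exists l : R[i], adjpow T k (x j) = l *: x j.

Definition weighted_shift x T : Prop :=
  exists a : nat -> R[i], forall k, T (x k) = a k *: x k.+1.

Definition rank_one (u v : H) : H -> H := fun y => dot y v *: u.

Definition star_relation T (a b c d : R) (k n : nat) : Prop :=
  forall y : H, a%:C *: y + b%:C *: adjpow T k y + c%:C *: adjpow T n y
                + d%:C *: adjpow T (k + n) y = 0.

End Operators.

(* Main.v *)
Require Import Defs.
From HB Require Import structures.
From mathcomp Require Import all_boot all_order all_algebra.
From mathcomp Require Import complex.
From mathcomp Require Import boolp classical_sets functions reals topology
  normedtype.
From mathcomp Require Import ring.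

Import Order.TTheory GRing.Theory Num.Theory.
Import numFieldNormedType.Exports.

Local Open Scope classical_set_scope.
Local Open Scope ring_scope.

(** Write P_k for T^{*k} T^k, E for the line ker T^*, spanned by the unit vector
    e, and M for M_E, the closed cyclic subspace of e for the commuting
    self-adjoint operators P_k.

    The first assertion holds through its second alternative: for k = n and any T
    the identity P_k - P_k = 0 has the required form, with a = d = 0, b = 1 and
    c = -1.  The content of the theorem is the last assertion, where the
    coefficient a is nonzero.

    Suppose dim M >= 3.  The identity T^* P_k T = P_(k+1) and the commutation of
    the P_k force P_k T P_1 = T P_(k+1) up to an operator with range in E
    (adjpow_iterT), and comparing P_k P_l with P_l P_k shows that the vectors
    P_k e are pairwise parallel modulo e (rank_one_defect).  Since e is cyclic,
    on M every P_k equals beta_k + lambda_k P_m, for one fixed index m and real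
    sequences beta, lambda (adjpow_ME).  A combination of the P_k all of whose
    shifts vanish at e vanishes everywhere (comb_total), so a relation between
    the P_k is the same thing as a linear recurrence satisfied by both
    sequences, that is, by the plane W which they span.

    Recurrences come from shifts that return to W.  Let r > 0 be minimal with
    T^r M not orthogonal to M.  Comparing P_k T^r with T^r P_(r+k) on M shows
    (first_return) that either the r-fold shift preserves W, and Cayley-Hamilton
    gives a recurrence, or the compression of T^r to M has rank one, and its
    kernel is the orthocomplement in M of a common eigenvector z of the P_k.  In
    the second case the r-fold shift takes the eigenvalue sequence w of z to a
    multiple w_r q of another element q of W, and W is spanned by w and q.  Let
    g be the component of T^r z orthogonal to M; it satisfies P_k g = q_k g.
    If T^n g or T^n u, with n > 0 and u in M orthogonal to z, ever fails to be
    orthogonal to M, then a second shift, longer than r, takes some nonzero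
    element of W into W; eliminating between the two gives a four-term recurrence
    (relation_of_two_shifts).  Otherwise a nonzero vector of M orthogonal to z
    and to T^r z, which exists because dim M >= 3, is orthogonal to the range of
    T and to z, although E is spanned by e and <z, e> is nonzero: a
    contradiction.

    Finally powers of T can be cancelled from a relation (comb_cancel), which
    makes the constant coefficient nonzero, and such a relation exhibits a left
    inverse of T with an adjoint, so that the range of T is closed. *)

(** * Inner products *)

Section InnerProduct.
Context {R : realType} {H : completeNormedModType R[i]}.
Variable dot : {dot H for (@Num.conj R[i])}.
Hypothesis dotE : forall x : H, dot x x = `|x| ^+ 2.

Lemma dotDl x y z : dot (x + y) z = dot x z + dot y z.
Proof. exact: linearDl. Qed.

Lemma dotDr x y z : dot x (y + z) = dot x y + dot x z.
Proof. exact: linearDr. Qed.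

Lemma dotNl x z : dot (- x) z = - dot x z.
Proof. exact: linearNl. Qed.

Lemma dotNr x z : dot x (- z) = - dot x z.
Proof. exact: linearNr. Qed.

Lemma dotZl (a : R[i]) x z : dot (a *: x) z = a * dot x z.
Proof. by rewrite linearZl_LR. Qed.

Lemma dotZr (a : R[i]) x z : dot x (a *: z) = (Num.conj a) * dot x z.
Proof. by rewrite linearZr_LR. Qed.

Lemma dot0l z : dot 0 z = 0.
Proof. exact: linear0l. Qed.

Lemma dot0r z : dot z 0 = 0.
Proof. exact: linear0r. Qed.

Lemma dotC x y : dot x y = Num.conj (dot y x).
Proof. by rewrite hermC expr0 mul1r. Qed.

Lemma dotC0 {x y} : dot x y = 0 -> dot y x = 0.
Proof. by move=> xy0; rewrite dotC xy0 rmorph0. Qed.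

Definition dotl := (dotDl, dotNl, dotZl, dot0l).
Definition dotr := (dotDr, dotNr, dotZr, dot0r).

Lemma dot_xx_eq0 x : dot x x = 0 -> x = 0.
Proof. by move/eqP; rewrite dnorm_eq0 => /eqP. Qed.

Lemma dot_extl x y : (forall z, dot x z = dot y z) -> x = y.
Proof.
move=> xy; apply/eqP; rewrite -subr_eq0; apply/eqP/dot_xx_eq0.
by rewrite dotDl dotNl xy subrr.
Qed.

Lemma dot_extr x y : (forall z, dot z x = dot z y) -> x = y.
Proof. by move=> xy; apply: dot_extl => z; rewrite dotC xy -dotC. Qed.

Lemma dot_sub_proj x u (c := dot x u / dot u u) : u != 0 ->
  dot (x - c *: u) (x - c *: u) = dot x x - `|dot x u| ^+ 2 / dot u u.
Proof.
move=> u0; have uu0 : dot u u != 0 by rewrite dnorm_eq0.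
have uuC : Num.conj (dot u u) = dot u u by rewrite -dotC.
rewrite !(dotl, dotr) normCK /c rmorphM fmorphV /= uuC (dotC u x).
by field.
Qed.

Lemma cauchy_schwarz x u : `|dot x u| <= `|x| * `|u|.
Proof.
have [->|u0] := eqVneq u 0; first by rewrite dot0r !normr0 mulr0.
rewrite -(ler_pXn2r (n := 2)) ?nnegrE ?mulr_ge0// exprMn -!dotE.
have uu0 : 0 < dot u u by rewrite dnorm_gt0.
by rewrite -ler_pdivrMr// -subr_ge0 -dot_sub_proj// dnorm_ge0.
Qed.

(** An additive functional with a linear bound has closed kernel: a nonzero value
    at x persists on the ball of radius |phi x| / (|K| + 1) around x. *)
Lemma closed_kernel (phi : H -> R[i]) (K : R[i]) :
  (forall x y, phi (x - y) = phi x - phi y) ->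
  (forall x, `|phi x| <= K * `|x|) -> closed [set x | phi x = 0].
Proof.
move=> phiB phiK x xcl /=; apply/eqP; apply: contraT => phix0.
have K1 : 0 < `|K| + 1 by rewrite ltr_wpDl.
have e0 : 0 < `|phi x| / (`|K| + 1) by rewrite divr_gt0 ?normr_gt0.
have [y [/= phiy0]] := xcl _ (nbhsx_ballx x _ e0).
rewrite -ball_normE /= => xy.
have := phiK (x - y); rewrite phiB phiy0 subr0 => phix.
move: xy; rewrite ltr_pdivlMr// => /lt_le_trans /(_ phix).
suff /le_lt_trans h : K * `|x - y| <= `|x - y| * (`|K| + 1).
  by move=> /h; rewrite ltxx.
have [/eqP ->|xy0] := boolP (`|x - y| == 0); first by rewrite mulr0 mul0r.
rewrite mulrC ler_pM2l ?lt_def ?xy0 ?normr_ge0//.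
rewrite (@le_trans _ _ `|K|) ?lerDl ?ler01// real_ler_norm//.
have : 0 <= K * `|x - y| by apply: le_trans (phiK _).
by rewrite pmulr_lge0 ?lt_def ?xy0 ?normr_ge0// => /ger0_real.
Qed.

Lemma orthocompl_closed (A : set H) : closed (orthocompl dot A).
Proof.
rewrite (_ : orthocompl dot A = \bigcap_(u in A) [set y | dot y u = 0]); last first.
  by apply/seteqP; split=> y /= Ay u /Ay /dotC0.
apply: closed_bigI => u _; apply: (closed_kernel (dot^~ u) `|u|) => [x y|x].
  by rewrite dotDl dotNl.
by rewrite mulrC cauchy_schwarz.
Qed.

Lemma orthocompl_subspace (A : set H) : is_subspace (orthocompl dot A).
Proof.
split=> [u _|a x y Ax Ay u Au]; first exact: dot0r.
by rewrite dotDr dotZr (Ax _ Au) (Ay _ Au) mulr0 addr0.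
Qed.

Lemma parallelogram x y :
  dot (x - y) (x - y) = 2 * dot x x + 2 * dot y y - dot (x + y) (x + y).
Proof. by rewrite !(dotl, dotr); ring. Qed.

End InnerProduct.
(** * Orthogonal projections and adjoints *)

Section Projection.
Context {R : realType} {H : completeNormedModType R[i]}.
Variable dot : {dot H for (@Num.conj R[i])}.
Hypothesis dotE : forall x : H, dot x x = `|x| ^+ 2.
Implicit Type V : set H.

Lemma inv_succ_small (eps : R[i]) : 0 < eps ->
  exists N : nat, forall n, (N <= n)%N -> n.+1%:R^-1 <= eps.
Proof.
move=> e0; have /complex_realP [r er] := gtr0_real e0.
have r0 : 0 < r by rewrite -(ltcR 0 r) -er.
exists (Num.truncn r^-1) => n Nn.
have -> : n.+1%:R^-1 = (n.+1%:R^-1)%:C%C :> R[i] by rewrite fmorphV rmorph_nat.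
rewrite er lecR invf_ple ?posrE ?ltr0n// ltW//.
by apply: lt_le_trans (truncnS_gt _) _; rewrite ler_nat ltnS.
Qed.

Lemma minimizing_sequence V x : is_subspace V ->
  exists (delta : R[i]) (u : nat -> H), [/\ forall n, V (u n),
    forall h, V h -> delta <= dot (x - h) (x - h) &
    forall n, dot (x - u n) (x - u n) <= delta + n.+1%:R^-1].
Proof.
move=> [V0 _]; pose q h := complex.Re (dot (x - h) (x - h)).
have qE h : (q h)%:C%C = dot (x - h) (x - h).
  by rewrite RRe_real// ger0_real// dnorm_ge0.
have q0 h : 0 <= q h by rewrite -(lecR 0) qE dnorm_ge0.
have Dinf : has_inf [set q h | h in V].
  by split; [exists (q 0); exists 0|exists 0 => _ [h _ <-]].
have H1 n : exists u, V u /\ q u <= inf [set q h | h in V] + n.+1%:R^-1.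
  have n0 : (0 : R) < n.+1%:R^-1 by rewrite invr_gt0.
  by have [_ [u Vu <-] /ltW uq] := inf_adherent n0 Dinf; exists u.
have [u uP] := choice H1.
exists (inf [set q h | h in V])%:C%C, u; split=> [n|h Vh|n].
- exact: (uP n).1.
- by rewrite -qE lecR; apply: ge_inf; [exact: Dinf.2|exists h].
- have -> : n.+1%:R^-1 = (n.+1%:R^-1)%:C%C :> R[i].
    by rewrite fmorphV rmorph_nat.
  by rewrite -qE -rmorphD lecR; exact: (uP n).2.
Qed.

(** By the parallelogram law a minimizing sequence for the distance to a
    closed subspace is Cauchy, and its limit is the foot of the perpendicular. *)
Lemma orthogonal_projection V x : is_subspace V -> closed V ->
  exists p, V p /\ forall h, V h -> dot (x - p) h = 0.
Proof.
move=> subV clV; have [delta [u [Vu dle uled]]] := minimizing_sequence V x subV.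
have [V0 Vlin] := subV.
have VD h k : V h -> V k -> V (h + k).
  by move=> Vh Vk; rewrite -[h]scale1r; apply: Vlin.
have VZ a h : V h -> V (a *: h).
  by move=> Vh; rewrite -[_ *: _]addr0; apply: Vlin.
have near_orth n h : V h -> `|dot (x - u n) h| ^+ 2 <= `|h| ^+ 2 * n.+1%:R^-1.
  move=> Vh; have [->|h0] := eqVneq h 0.
    by rewrite dot0r !normr0 expr0n mul0r.
  have hh0 : 0 < dot h h by rewrite dnorm_gt0.
  rewrite -dotE mulrC -ler_pdivrMr//.
  (* compare u n with the best approximation on the line u n + C h *)
  have := dle _ (VD _ _ (Vu n) (VZ (dot (x - u n) h / dot h h) h Vh)).
  rewrite opprD addrA dot_sub_proj// lerBrDr => /le_trans/(_ (uled n)).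
  by rewrite lerD2l.
have dist n m : `|u n - u m| ^+ 2 <= 2 * (n.+1%:R^-1 + m.+1%:R^-1).
  have -> : u n - u m = (x - u m) - (x - u n).
    by apply/esym; rewrite opprB addrC addrA addrNK.
  rewrite -dotE parallelogram.
  have -> : (x - u m) + (x - u n) = 2 *: (x - 2^-1 *: (u m + u n)).
    by rewrite scalerBr scalerA divff ?scale1r ?pnatr_eq0// scaler_nat
      mulr2n addrACA opprD.
  rewrite dotZl dotZr conjC_nat lerBlDr.
  have Vmid : V (2^-1 *: (u m + u n)) by apply: VZ; apply: VD.
  have h1 : 2 * dot (x - u m) (x - u m) <= 2 * (delta + m.+1%:R^-1).
    by rewrite ler_pM2l// ltr0n.
  have h2 : 2 * dot (x - u n) (x - u n) <= 2 * (delta + n.+1%:R^-1).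
    by rewrite ler_pM2l// ltr0n.
  apply: (le_trans (lerD h1 h2)).
  rewrite (_ : _ + _ = 2 * (n.+1%:R^-1 + m.+1%:R^-1) + 2 * (2 * delta));
    last by ring.
  by rewrite lerD2l !ler_pM2l ?ltr0n// dle.
have /cauchy_cvgP /cvg_ex [p up] : cauchy (u @ \oo).
  apply: cauchy_exP => eps e0.
  have e2 : 0 < (eps / 2) ^+ 2 / 4 by rewrite !(divr_gt0, exprn_gt0).
  have [N NP] := inv_succ_small _ e2.
  exists (u N); exists N => // n /= Nn.
  rewrite -ball_normE /=.
  have e4 : 0 <= eps / 2 by rewrite ltW// divr_gt0.
  apply: (@le_lt_trans _ _ (eps / 2)); last first.
    by rewrite ltr_pdivrMr// ltr_pMr// ltr1n.
  rewrite -(ler_pXn2r (n := 2)) ?nnegrE//.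
  apply: le_trans (dist _ _) _; rewrite -ler_pdivlMl ?ltr0n//.
  apply: le_trans (lerD (NP _ (leqnn N)) (NP _ Nn)) _.
  by rewrite le_eqVlt; apply/orP; left; apply/eqP; field.
have Vp : V p by apply: (closed_cvg V clV _ p up); apply: nearW.
exists p; split=> // h Vh; apply/eqP/negPn/negP => xph.
have h0 : 0 < `|h|.
  by rewrite normr_gt0; apply: contra xph => /eqP ->; rewrite dot0r.
(* a radius small enough to bound |<x - p, h>| by half of itself *)
have e0 : 0 < `|dot (x - p) h| / (4 * `|h|).
  by rewrite divr_gt0 ?normr_gt0 ?mulr_gt0 ?ltr0n.
have [N NP] := inv_succ_small _ (exprn_gt0 2 e0).
have [N' _ NP'] := (cvgrPdist_lt _ _).1 up _ e0.
have {NP'} /= pun := NP' (maxn N N') (leq_maxr _ _).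
have {NP} := NP (maxn N N') (leq_maxl _ _).
move: (maxn N N') pun => n /ltW pun n1.
have : `|dot (x - u n) h| <= `|h| * (`|dot (x - p) h| / (4 * `|h|)).
  rewrite -(ler_pXn2r (n := 2)) ?nnegrE//; last by rewrite mulr_ge0// ltW.
  by rewrite exprMn (le_trans (near_orth _ _ Vh))// ler_wpM2l// exprn_ge0.
have : `|dot (p - u n) h| <= (`|dot (x - p) h| / (4 * `|h|)) * `|h|.
  by rewrite (le_trans (cauchy_schwarz _ dotE _ _))// ler_wpM2r.
rewrite -(normrN (dot (p - u n) h)) => a b; have := lerD b a.
move/(le_trans (ler_normD _ _)).
rewrite -dotNl -dotDl opprB addrA addrNK.
rewrite (_ : _ + _ = `|dot (x - p) h| / 2); last first.
  by field; rewrite gt_eqF.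
rewrite ler_pdivlMr// ger_pMr ?normr_gt0//.
by rewrite (ler_nat _ 2 1).
Qed.
End Projection.
Section Adjoint.
Context {R : realType} {H : completeNormedModType R[i]}.
Variable dot : {dot H for (@Num.conj R[i])}.
Hypothesis dotE : forall x : H, dot x x = `|x| ^+ 2.

(** The representing vector is a multiple of the component w of any x with
    phi x <> 0 that is orthogonal to the kernel of phi. *)
Lemma riesz (phi : H -> R[i]) :
  (forall a x y, phi (a *: x + y) = a * phi x + phi y) ->
  closed [set x | phi x = 0] -> exists z, forall x, phi x = dot x z.
Proof.
move=> philin clphi.
have phi0 : phi 0 = 0.
  by have := philin (-1) 0 0; rewrite scaler0 addr0 mulN1r addNr.
have [[x phix]|noex] := pselect (exists x, phi x != 0); last first.
  exists 0 => x; rewrite dot0r; apply/eqP/negPn/negP => phix.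
  by apply: noex; exists x.
have subV : is_subspace [set x | phi x = 0].
  by split=> //= a u w; rewrite philin => -> ->; rewrite mulr0 addr0.
have [p [/= phip xp]] := orthogonal_projection _ dotE _ x subV clphi.
pose w := x - p.
have phiw : phi w = phi x.
  have := philin (-1) p x; rewrite phip mulr0 add0r => <-.
  by rewrite scaleN1r addrC.
have ww0 : dot w w != 0.
  rewrite dnorm_eq0; apply: contraNneq phix => w0.
  by rewrite -phiw w0 phi0.
have wwC : Num.conj (dot w w) = dot w w by rewrite -dotC.
exists (Num.conj (phi w / dot w w) *: w) => u.
have Vu : phi (- (phi u / phi w) *: w + u) = 0.
  by rewrite philin phiw mulNr mulfVK// addNr.
have := xp _ Vu; rewrite -/w => /dotC0; rewrite dotDl dotZl => /eqP.
rewrite addrC addr_eq0 => /eqP uw; rewrite dotZr conjCK uw phiw.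
by field; rewrite phix.
Qed.

Lemma adjointP (T : {linear H -> H}) : bounded_operator T ->
  forall u y, dot (T u) y = dot u (adjoint dot T y).
Proof.
move=> /linear_boundedP Tb u y.
suff : exists z, forall u, dot (T u) y = dot u z.
  by move=> /(@xgetPex _ 0) h; exact: h.
apply: riesz => [a v w|]; first by rewrite linearP dotDl dotZl.
have [K /= TK] : exists K, forall x, `|T x| <= K * `|x|.
  by near +oo_R[i] => K; exists K; near: K.
apply: (closed_kernel (fun u => dot (T u) y) (K * `|y|)) => [v w|v].
  by rewrite linearB dotDl dotNl.
apply: le_trans (cauchy_schwarz _ dotE _ _) _.
by rewrite mulrAC ler_wpM2r.
Unshelve. all: by end_near. Qed.

End Adjoint.
(** * Half-centered operators with one-dimensional cokernel *)

Section HalfCentered.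
Context {R : realType} {H : completeNormedModType R[i]}.
Variable dot : {dot H for (@Num.conj R[i])}.
Hypothesis dotE : forall x : H, dot x x = `|x| ^+ 2.
Variable T : {linear H -> H}.
Notation S := (adjoint dot T).
Notation P := (adjpow dot T).
Notation M := (M_E dot T).
Hypothesis adjT : forall u y, dot (T u) y = dot u (S y).
Hypothesis Tinj : injective T.
Hypothesis Thc : half_centered dot T.

Lemma iter_linear k a u w :
  iter k T (a *: u + w) = a *: iter k T u + iter k T w.
Proof. by elim: k => //= k ->; rewrite linearP. Qed.

Lemma iterT0 k : iter k T 0 = 0.
Proof. by elim: k => //= k ->; rewrite linear0. Qed.

Lemma adjT_iter k u y : dot (iter k T u) y = dot u (iter k S y).
Proof. by elim: k y => //= k IH y; rewrite adjT IH -iterSr. Qed.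

Lemma adjpow_dot k u h : dot (P k u) h = dot (iter k T u) (iter k T h).
Proof. by rewrite dotC -adjT_iter -dotC. Qed.

Lemma adjpow_sym k u h : dot (P k u) h = dot u (P k h).
Proof. by rewrite adjpow_dot dotC -adjpow_dot -dotC. Qed.

Lemma adjpow_linear k a u w : P k (a *: u + w) = a *: P k u + P k w.
Proof.
apply: (dot_extl dot) => x.
by rewrite dotDl dotZl !adjpow_dot iter_linear dotDl dotZl.
Qed.

Lemma adjpow_at0 k : P k 0 = 0.
Proof. by apply: (dot_extl dot) => x; rewrite adjpow_dot iterT0 !dot0l. Qed.

Lemma adjpowZ k a u : P k (a *: u) = a *: P k u.
Proof. by rewrite -[a *: u]addr0 adjpow_linear adjpow_at0 addr0. Qed.

Lemma adjpowD k u w : P k (u + w) = P k u + P k w.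
Proof. by rewrite -[u in LHS]scale1r adjpow_linear scale1r. Qed.

Lemma adjpowB k u w : P k (u - w) = P k u - P k w.
Proof. by rewrite adjpowD -scaleN1r adjpowZ scaleN1r. Qed.

Lemma adjpowC i j u : P i (P j u) = P j (P i u).
Proof.
case: i => [//|i]; case: j => [//|j].
exact: (congr1 (@^~ u) (Thc _ _ (ltn0Sn i) (ltn0Sn j))).
Qed.

(** The weak form of T^{*n} P_k T^n = P_(n+k). *)
Lemma adjpow_iter n k u w :
  dot (P k (iter n T u)) (iter n T w) = dot (P (n + k) u) w.
Proof. by rewrite !adjpow_dot -!iterD addnC. Qed.

Lemma iterT_inj k u : iter k T u = 0 -> u = 0.
Proof.
elim: k => //= k IH Tu0; apply: IH; apply: Tinj.
by rewrite linear0.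
Qed.

Lemma adjpow_inj k u : P k u = 0 -> u = 0.
Proof.
move=> Pu0; apply/(iterT_inj k)/(dot_xx_eq0 dot).
by rewrite -adjpow_dot Pu0 dot0l.
Qed.

Variable e : H.
Hypothesis ee : dot e e = 1.
Hypothesis ranT_e : forall u, dot (T u) e = 0.
Hypothesis ranT_perp :
  forall d, (forall u, dot (T u) d = 0) -> d = dot d e *: e.
Hypothesis Tspan :
  closed_span (\bigcup_(k in [set: nat]) (iter k T @` M)) = [set: H].

Lemma iterT_e k u : (0 < k)%N -> dot (iter k T u) e = 0.
Proof. by case: k => // k _ /=; rewrite ranT_e. Qed.

Lemma ME_subspace : is_subspace M.
Proof.
split=> [V [[[V0 _] _ _] _]//|a x y Mx My V VP].
by have [[[_ Vlin] _ _] _] := VP; exact: Vlin (Mx V VP) (My V VP).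
Qed.

Lemma ME_closed : closed M.
Proof. by apply: closed_bigI => V [[_ clV _] _]. Qed.

Lemma ME_adjpow k u : M u -> M (P k u).
Proof. by move=> Mu V VP; have [[_ _ VPk] _] := VP; exact: VPk (Mu V VP). Qed.

Lemma ME_e : M e.
Proof.
move=> V [_]; apply; apply: (dot_extr dot) => u.
by rewrite -adjT ranT_e dot0r.
Qed.

Lemma ME_min (V : set H) : is_subspace V -> closed V ->
  (forall k u, V u -> V (P k u)) -> V e -> M `<=` V.
Proof.
move=> subV clV VP Ve; apply: smallest_sub => // y Sy0.
rewrite (ranT_perp y); last by move=> u; rewrite adjT Sy0 dot0r.
by rewrite -[_ *: _]addr0; apply: subV.2 => //; exact: subV.1.
Qed.

Lemma ME_Z a u : M u -> M (a *: u).
Proof.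
have [M0 Mlin] := ME_subspace.
by move=> Mu; rewrite -[_ *: _]addr0; apply: Mlin.
Qed.

Lemma ME_D u w : M u -> M w -> M (u + w).
Proof. by move=> Mu Mw; rewrite -[u]scale1r; apply: ME_subspace.2. Qed.

Lemma ME_B u w : M u -> M w -> M (u - w).
Proof. by move=> Mu Mw; rewrite -scaleN1r; apply: ME_D => //; apply: ME_Z. Qed.

(** The hypothesis that the subspaces T^k M_E span, as an induction principle. *)
Lemma iterT_ME_total (V : set H) : is_subspace V -> closed V ->
  (forall k u, M u -> V (iter k T u)) -> forall h, V h.
Proof.
move=> subV clV VT h.
have : [set: H] h by [].
rewrite -Tspan /closed_span closureE; apply: smallest_sub => //.
by apply: smallest_sub => // _ [k _ [u Mu <-]]; exact: VT.
Qed.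

(** A vector orthogonal to every T^j M_E with j > 0 is orthogonal to the range
    of T, because the T^j M_E span the whole space. *)
Lemma perp_iterT d : (forall j u, M u -> dot d (iter j.+1 T u) = 0) ->
  d = dot d e *: e.
Proof.
move=> dT; apply: ranT_perp => h.
suff /(_ (S d) erefl) Sdh : orthocompl dot [set S d] h.
  by rewrite adjT; exact: dotC0.
apply: (iterT_ME_total (orthocompl dot [set S d])) => [||k u Mu _ ->].
- exact: orthocompl_subspace.
- exact: orthocompl_closed.
- by apply: dotC0; rewrite -adjT; apply: dotC0; exact: dT.
Qed.

Definition perpM h := forall w, M w -> dot h w = 0.

Lemma perpM_adjpow k h : perpM h -> perpM (P k h).
Proof. by move=> hM w Mw; rewrite adjpow_sym hM//; exact: ME_adjpow. Qed.

Lemma perpM_ME h : M h -> perpM h -> h = 0.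
Proof. by move=> Mh hM; apply/(dot_xx_eq0 dot)/hM. Qed.

(** A common eigenvector orthogonal to e is orthogonal to every vector reached
    from e by the self-adjoint operators P_k. *)
Lemma eigenvector_perpM h : (forall k, exists a, P k h = a *: h) ->
  dot h e = 0 -> perpM h.
Proof.
move=> hP he w Mw.
suff : orthocompl dot [set h] w by move/(_ h erefl).
apply: (ME_min (orthocompl dot [set h])) Mw => [|||_ ->//].
- exact: orthocompl_subspace.
- exact: orthocompl_closed.
- move=> k u hu _ ->; have [a Pa] := hP k.
  by rewrite -adjpow_sym Pa dotZl hu// mulr0.
Qed.

(** The hypothesis under which T^n h is the first iterate seen by M_E; it is
    vacuous for n = 1. *)
Definition perp_below n h :=
  forall j i, (0 < j < n)%N -> perpM (iter j T (P i h)).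

(** The defect of commutation of T^n with the operators P_k is orthogonal to
    all T^j M_E with j > 0, hence is a multiple of e. *)
Lemma adjpow_iterT n k h : (0 < n)%N -> perp_below n h ->
  P k (iter n T (P n h)) =
  iter n T (P (n + k) h) + dot (iter n T (P n h)) (P k e) *: e.
Proof.
move=> n0 hn; set d := P k (iter n T (P n h)) - iter n T (P (n + k) h).
have dE : d = dot d e *: e.
  apply: perp_iterT => j u Mu; rewrite /d dotDl dotNl.
  have [nj|jn] := leqP n j.+1.
    rewrite -(subnKC nj) !(iterD n) adjpow_iter -adjpow_dot.
    by rewrite (adjpowC n) subrr.
  have jn' : (0 < n - j.+1 < n)%N.
    by rewrite subn_gt0 jn ltn_subrL n0.
  (* below n both terms are carried by T^(n-j-1), where h is unseen by M_E *)
  rewrite -{1 3}(subnKC (ltnW jn)) !(iterD j.+1 (n - j.+1)) adjpow_iter.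
  rewrite adjpow_sym -[dot (iter _ T (iter _ T _)) _]adjpow_dot adjpow_sym.
  by rewrite !hn ?subr0//; exact: ME_adjpow.
have de : dot d e = dot (iter n T (P n h)) (P k e).
  by rewrite /d dotDl dotNl adjpow_sym [dot (iter _ T (P (_ + _) _)) _]iterT_e// subr0.
by rewrite -de -dE addrC subrK.
Qed.

Definition alpha k := dot (P k e) e.

Lemma alpha_real k : Num.conj (alpha k) = alpha k.
Proof. by rewrite /alpha -dotC adjpow_sym. Qed.

(** Antisymmetrize in k and l the expression of P_k P_l T P_1^2 u obtained from
    two uses of adjpow_iterT at n = 1: only multiples of e survive besides the
    two displayed terms, and x is orthogonal to e. *)
Lemma defect_parallel k l u x (y := iter 1 T (P 1 (P 1 u))) : dot e x = 0 ->
  dot y (P k e) * dot (P l e) x = dot y (P l e) * dot (P k e) x.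
Proof.
move=> ex.
have good h : perp_below 1 h by case=> [|j] i; rewrite ?ltnS ?ltn0 ?andbF.
have key i j : dot (P i (P j y)) x - dot y (P j e) * dot (P i e) x =
    dot (iter 1 T (P (1 + i) (P (1 + j) u))) x.
  have := adjpow_iterT 1 j (P 1 u) (ltn0Sn 0) (good _).
  rewrite -/y => ->; rewrite adjpowD adjpowZ (adjpowC (1 + j) 1).
  rewrite adjpow_iterT// !dotl ex mulr0 addr0.
  by rewrite addrK.
have := key k l; have := key l k.
rewrite (adjpowC (1 + l)) (adjpowC l k) => <- /addrI /oppr_inj.
by [].
Qed.

(** The vectors P_k e are pairwise parallel modulo e, because the vectors
    T P_1^2 u in defect_parallel fill a dense subspace of the orthocomplement
    of e. *)
Lemma rank_one_defect k l x : dot e x = 0 ->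
  exists c, Num.conj (dot (P l e) x) *: P k e
    - Num.conj (dot (P k e) x) *: P l e = c *: e.
Proof.
move=> ex; set y := _ - _; exists (dot y e); apply: ranT_perp => h.
suff Sy0 : P 1 (P 1 (S y)) = 0.
  by rewrite adjT (adjpow_inj 1 _ (adjpow_inj 1 _ Sy0)) dot0r.
apply: (dot_extr dot) => u.
rewrite dot0r -!adjpow_sym -adjT /y !dotr !conjCK.
rewrite [_ * _]mulrC [X in _ - X]mulrC; apply/eqP; rewrite subr_eq0; apply/eqP.
exact: (defect_parallel k l u).
Qed.

(** * The plane of sequences spanned by beta and lambda *)

Variable m : nat.
Variable v : H.
Hypothesis vE : v = P m e - alpha m *: e.
Hypothesis v0 : v != 0.

Definition lambda k := dot (P k e) v / dot v v.

Lemma vdir_e : dot v e = 0.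
Proof. by rewrite vE !dotl ee mulr1 subrr. Qed.

Lemma vdir_v : dot v v != 0.
Proof. by rewrite dnorm_eq0. Qed.

Lemma adjpow_e_real k :
  P k e = alpha k *: e + lambda k *: v /\ Num.conj (lambda k) = lambda k.
Proof.
have ev := dotC0 dot vdir_e.
have vR : Num.conj (dot v v) = dot v v by rewrite -dotC.
have Pmv : dot (P m e) v = dot v v.
  by rewrite {2}vE !dotl ev mulr0 subr0.
have [c] := rank_one_defect k m v ev.
rewrite Pmv vR => /eqP; rewrite subr_eq => /eqP Pk.
have := congr1 (dot^~ v) Pk; rewrite !dotl ev mulr0 add0r Pmv.
rewrite mulrC => /(mulIf vdir_v) lamR.
have Pk' : P k e = (c / dot v v) *: e + lambda k *: P m e.
  rewrite /lambda {1}lamR ![_ / _]mulrC -!scalerA -scalerDr -Pk scalerA.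
  by rewrite mulVf ?vdir_v// scale1r.
split; last by rewrite /lambda rmorphM fmorphV /= vR -lamR.
have := congr1 (dot^~ e) Pk'; rewrite !dotl ee mulr1 -/(alpha k) -/(alpha m).
move=> ->; rewrite {1}Pk' vE.
apply: (dot_extl dot) => z; rewrite !dotl; ring.
Qed.

Lemma lambda_real k : Num.conj (lambda k) = lambda k.
Proof. by have [] := adjpow_e_real k. Qed.

(** The coordinates of P_k e are (beta k, lambda k) in the basis e, P_m e. *)
Definition beta k := alpha k - lambda k * alpha m.

Lemma beta_real k : Num.conj (beta k) = beta k.
Proof. by rewrite /beta rmorphB rmorphM /= !alpha_real lambda_real. Qed.

Lemma adjpow_e k : P k e = beta k *: e + lambda k *: P m e.
Proof.
have [-> _] := adjpow_e_real k; rewrite vE /beta.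
by apply: (dot_extl dot) => z; rewrite !dotl; ring.
Qed.

Lemma lambda_m : lambda m = 1.
Proof.
rewrite /lambda {1}(_ : P m e = v + alpha m *: e); last by rewrite vE subrK.
by rewrite dotDl dotZl (dotC0 dot vdir_e) mulr0 addr0 divff// vdir_v.
Qed.

Lemma beta_m : beta m = 0.
Proof. by rewrite /beta lambda_m mul1r subrr. Qed.

(** * Linear relations between the P_k *)

(** A pair (c, i) of s stands for the term c P_(i+j): the parameter j shifts all
    indices, which is the effect of putting T^{*j} and T^j around the operator. *)
Definition comb (s : seq (R[i] * nat)) j h :=
  \sum_(t <- s) t.1 *: P (t.2 + j) h.

Definition conjs (s : seq (R[i] * nat)) := [seq (Num.conj t.1, t.2) | t <- s].

Lemma conjsK s : conjs (conjs s) = s.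
Proof.
rewrite /conjs -map_comp map_id_in// => -[a k] _ /=.
by rewrite conjCK.
Qed.

Lemma comb_dot s j u w : dot (comb s j u) w = dot u (comb (conjs s) j w).
Proof.
rewrite /comb; elim: s => [|t s IH]; first by rewrite !big_nil dot0l dot0r.
by rewrite /= !big_cons !(dotl, dotr) /= conjCK IH adjpow_sym.
Qed.

Lemma comb_ME s j u : M u -> M (comb s j u).
Proof.
move=> Mu; rewrite /comb; elim: s => [|t s IH].
  by rewrite big_nil; exact: ME_subspace.1.
by rewrite big_cons; apply: ME_D => //; apply: ME_Z; apply: ME_adjpow.
Qed.

Lemma comb_iter s j n u w :
  dot (comb s j (iter n T u)) (iter n T w) = dot (comb s (n + j) u) w.
Proof.
rewrite /comb; elim: s => [|t s IH]; first by rewrite !big_nil !dot0l.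
by rewrite !big_cons !dotl IH adjpow_iter addnCA.
Qed.

(** The kernel is closed because it is the orthocomplement of the range of the
    adjoint. *)
Lemma comb_kernel s j (A : set H := orthocompl dot (range (comb (conjs s) j))) :
  [/\ is_subspace A, closed A & forall u, A u <-> comb s j u = 0].
Proof.
rewrite /A; split=> [||u].
- exact: orthocompl_subspace.
- exact: orthocompl_closed.
split=> [Au|u0 _ [x _ <-]].
  apply: (dot_extr dot) => z; rewrite dot0r -[s]conjsK -comb_dot.
  by apply: Au; exists z.
by rewrite comb_dot conjsK u0 dot0r.
Qed.

Lemma comb_adjpow s j k u : comb s j (P k u) = P k (comb s j u).
Proof.
rewrite /comb; elim: s => [|t s IH]; first by rewrite !big_nil adjpow_at0.
by rewrite !big_cons adjpowD adjpowZ IH adjpowC.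
Qed.

(** The operator comb s j commutes with every P_k, so it vanishes on M_E as
    soon as it kills the cyclic vector e. *)
Lemma comb_e_ME s j : comb s j e = 0 -> forall u, M u -> comb s j u = 0.
Proof.
move=> se u Mu; have [subA clA AP] := comb_kernel s j.
apply/AP; move: u Mu; apply: (ME_min _ subA clA) => [k u /AP su|]; apply/AP => //.
by rewrite comb_adjpow su adjpow_at0.
Qed.

(** comb s j commutes with its adjoint comb (conjs s) j: it is normal. *)
Lemma comb_conjs_e s j : comb s j e = 0 -> comb (conjs s) j e = 0.
Proof.
move=> se; apply: (dot_xx_eq0 dot); rewrite comb_dot conjsK.
by rewrite (comb_e_ME _ _ se) ?dot0r//; apply: comb_ME; exact: ME_e.
Qed.

(** The operator P_k - beta_k - lambda_k P_m kills the cyclic vector e. *)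
Lemma adjpow_ME k u : M u -> P k u = beta k *: u + lambda k *: P m u.
Proof.
pose s : seq (R[i] * nat) := [:: (1, k); (- beta k, 0%N); (- lambda k, m)].
have sE x : comb s 0 x = P k x - (beta k *: x + lambda k *: P m x).
  rewrite /comb !big_cons big_nil /= !addn0 scale1r !scaleNr addr0.
  by rewrite opprD addrA.
have se : comb s 0 e = 0 by rewrite sE adjpow_e subrr.
by move=> Mu; have := comb_e_ME _ _ se u Mu; rewrite sE => /eqP; rewrite subr_eq0 => /eqP.
Qed.

(** If T^* X T vanishes then X maps the range of T into the line of e, and a
    self-adjointness argument removes this line when X e vanishes too.
    Applied along T^k M_E, this propagates relations from M_E to the space. *)
Lemma comb_total s j :
  (forall i, comb s (i + j) e = 0) -> forall h, comb s j h = 0.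
Proof.
move=> se h; have [subA clA AP] := comb_kernel s j.
apply/AP; apply: (iterT_ME_total _ subA clA) => k u Mu; apply/AP => {subA clA AP h}.
elim: k j se => [|k IH] j se /=; first exact: comb_e_ME (se 0%N) _ Mu.
have se0 := comb_conjs_e _ _ (se 0%N).
rewrite [LHS]ranT_perp; first by rewrite comb_dot se0 dot0r scale0r.
move=> x; apply: dotC0; rewrite (comb_iter s j 1 (iter k T u) x).
rewrite IH ?dot0l// => i; rewrite addnA addn1 addSnnS.
by have := se i.+1; rewrite addSnnS.
Qed.

Definition betasum s j := \sum_(t <- s) t.1 * beta (t.2 + j).
Definition lambdasum s j := \sum_(t <- s) t.1 * lambda (t.2 + j).

Lemma combE s j u : M u ->
  comb s j u = betasum s j *: u + lambdasum s j *: P m u.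
Proof.
move=> Mu; rewrite /comb /betasum /lambdasum; elim: s => [|t s IH].
  by rewrite !big_nil !scale0r addr0.
rewrite !big_cons IH adjpow_ME//.
by apply: (dot_extl dot) => z; rewrite !dotl; ring.
Qed.

(* dim M_E >= 3 enters as the solvability of two linear conditions in M_E *)
Hypothesis dim3 : forall p q,
  exists u, [/\ M u, u != 0, dot u p = 0 & dot u q = 0].

Definition eigenvalues (s : R[i]) k := beta k + lambda k * s.

Lemma eigenvector_ME u a : M u -> P m u = a *: u ->
  forall k, P k u = eigenvalues a k *: u.
Proof. by move=> Mu Pu k; rewrite adjpow_ME// Pu scalerA -scalerDl. Qed.

Lemma eigenvector_e u a : M u -> P m u = a *: u -> dot u e = 0 -> u = 0.
Proof.
move=> Mu Pu ue; apply: perpM_ME => //; apply: eigenvector_perpM => // k.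
by rewrite (eigenvector_ME _ _ Mu Pu); eexists.
Qed.

(** Cancellation of T^* and T around X: the hypothesis leaves for X only an
    operator of rank at most two, built from e and X e. A vector of M_E
    orthogonal to e and P_m e is thus killed by X, while X is affine in P_m
    on M_E and no eigenvector of P_m in M_E is orthogonal to e. *)
Lemma comb_cancel s j : (forall h, comb s j.+1 h = 0) -> forall h, comb s j h = 0.
Proof.
move=> sj; have [u [Mu u0 ue uP]] := dim3 e (P m e).
have su : comb s j u = 0.
  rewrite [LHS]ranT_perp.
    rewrite comb_dot combE ?dotr ?ue ?uP ?mulr0 ?addr0 ?scale0r//; exact: ME_e.
  move=> h; apply: dotC0; rewrite comb_dot.
  rewrite (ranT_perp (comb _ j (T h))) ?dotZr ?ue ?mulr0// => x.
  by apply: dotC0; rewrite (comb_iter _ j 1 h x) comb_dot conjsK sj dot0r.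
move: (su); rewrite combE// => /eqP.
have [l0|l0] := eqVneq (lambdasum s j) 0; last first.
  rewrite addrC addr_eq0 => /eqP Pu; case/eqP: u0.
  apply: (eigenvector_e _ (- ((lambdasum s j)^-1 * betasum s j))) => //.
  by rewrite scaleNr -scalerA -scalerN -Pu scalerA mulVf// scale1r.
rewrite l0 scale0r addr0 scaler_eq0 (negbTE u0) orbF => /eqP b0.
apply: comb_total => -[|i].
  by rewrite combE ?l0 ?b0 ?scale0r ?addr0//; exact: ME_e.
apply: (dot_extl dot) => w; rewrite dot0l addSnnS.
by rewrite -comb_iter sj dot0l.
Qed.

Lemma comb_descend s j : (forall h, comb s j h = 0) -> forall h, comb s 0 h = 0.
Proof. by elim: j => // j IH /comb_cancel. Qed.

(** * First return of the iterates of T to M_E *)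

Lemma iterTZ k a u : iter k T (a *: u) = a *: iter k T u.
Proof. by rewrite -[a *: u]addr0 iter_linear iterT0 addr0. Qed.

Lemma iterTB k u w : iter k T (u - w) = iter k T u - iter k T w.
Proof. by rewrite addrC -scaleN1r iter_linear scaleN1r addrC. Qed.

(** Eliminate, between adjpow_iterT at k and at m, the rank one term along e;
    its coefficient is proportional to lambda_k. *)
Lemma iterT_defect n k h : (0 < n)%N -> perp_below n h ->
  perpM (iter n T
    (P (n + k) h - (lambda k *: P (n + m) h + beta k *: P n h))).
Proof.
move=> n0 hn w Mw; set y := iter n T (P n h).
have tE i : dot (iter n T (P (n + i) h)) w = dot y (P i w) - dot y (P i e) * dot e w.
  have /(congr1 (dot^~ w)) := adjpow_iterT n i h n0 hn.
  by rewrite -/y dotDl dotZl adjpow_sym => ->; rewrite addrK.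
have ye : dot y e = 0 by exact: iterT_e.
rewrite iterTB iter_linear iterTZ !dotl !tE -/y (adjpow_ME k w)// (adjpow_e k).
by rewrite !dotr !beta_real !lambda_real ye; ring.
Qed.

(** If T^n h is not orthogonal to M_E, then the shifted eigenvalue sequence
    of the eigenvector h is again a combination of lambda and beta. *)
Lemma eigenvector_defect n h a w : (0 < n)%N -> (forall k, P k h = a k *: h) ->
  (forall j, (0 < j < n)%N -> perpM (iter j T h)) ->
  M w -> dot (iter n T h) w != 0 ->
  forall k, a (n + k)%N = lambda k * a (n + m)%N + beta k * a n.
Proof.
move=> n0 Ph hn Mw nz k.
have good : perp_below n h.
  by move=> j i jn x Mx; rewrite Ph iterTZ dotZl hn// mulr0.
have := iterT_defect n k h n0 good w Mw.
rewrite !Ph !scalerA -scalerDl -scalerBl iterTZ dotZl => /eqP.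
by rewrite mulf_eq0 (negbTE nz) orbF subr_eq0 => /eqP.
Qed.

(** The n-fold shift maps the span of beta and lambda to itself. *)
Definition shift_stable n := forall k,
  beta (n + k)%N = lambda k * beta (n + m)%N + beta k * beta n /\
  lambda (n + k)%N = lambda k * lambda (n + m)%N + beta k * lambda n.

Section FirstReturn.
Variable G : set H.
Hypotheses (Gsub : is_subspace G) (Gcl : closed G) (GM : G `<=` M).
Hypothesis GP : forall k u, G u -> G (P k u).

(** The compression of T^n from G to M_E intertwines the P_k up to a rank one
    error, so it is killed by the operators x + y P_m measuring the failure of
    stability; if one of them is nonzero, the compression has rank one and the
    orthocomplement of its kernel is spanned by an eigenvector. *)
Lemma first_return n u0 w0 : (0 < n)%N ->
  (forall j u, (0 < j < n)%N -> G u -> perpM (iter j T u)) ->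
  G u0 -> M w0 -> dot (iter n T u0) w0 != 0 ->
  shift_stable n \/
  exists z a, [/\ G z, z != 0, P m z = a *: z, dot (iter n T z) w0 != 0 &
    forall u, G u -> dot u z = 0 -> perpM (iter n T u)].
Proof.
move=> n0 Gn Gu0 Mw0 nz.
(* on M_E the operator of iterT_defect is x k + y k P_m *)
pose x k := beta (n + k)%N - (lambda k * beta (n + m)%N + beta k * beta n).
pose y k := lambda (n + k)%N - (lambda k * lambda (n + m)%N + beta k * lambda n).
have xyP k u : G u -> perpM (iter n T (x k *: u + y k *: P m u)).
  move=> Gu; have good : perp_below n u by move=> j i jn; apply: Gn => //; exact: GP.
  have := iterT_defect n k u n0 good.
  have Mu := GM _ Gu.
  rewrite (adjpow_ME (n + k) _ Mu) (adjpow_ME (n + m) _ Mu) (adjpow_ME n _ Mu).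
  congr (perpM (iter n T _)); apply: (dot_extl dot) => t.
  by rewrite /x /y !dotl; ring.
have [st|nst] := pselect (shift_stable n); [by left|right].
have [k xy0] : exists k, ~~ ((x k == 0) && (y k == 0)).
  apply/not_existsP => nk; apply: nst => k.
  have /negP := nk k; rewrite negbK => /andP[/eqP x0 /eqP y0].
  by split; apply/eqP; rewrite -subr_eq0; apply/eqP.
have y0 : y k != 0.
  apply/negP => /eqP y0; move: xy0; rewrite y0 eqxx andbT => x0.
  have := xyP k u0 Gu0 w0 Mw0; rewrite y0 scale0r addr0 iterTZ dotZl => /eqP.
  by rewrite mulf_eq0 (negbTE x0) (negbTE nz).
pose b := - (x k / y k).
have bP u : G u -> perpM (iter n T (P m u - b *: u)).
  move=> Gu t Mt; have := xyP k u Gu t Mt.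
  rewrite (_ : _ + _ = y k *: (P m u - b *: u)) => [|].
    by rewrite iterTZ dotZl => /eqP; rewrite mulf_eq0 (negbTE y0) => /eqP.
  rewrite scalerBr scalerA /b mulrN scaleNr opprK addrC; congr (_ + _ *: _).
  by field.
(* z is the projection to G of T^{*n} w *)
have comp w : M w -> exists z, [/\ G z, P m z = Num.conj b *: z &
    forall u, G u -> dot (iter n T u) w = dot u z].
  move=> Mw; have [z [Gz zP]] := orthogonal_projection dot dotE _ (iter n S w) Gsub Gcl.
  have uz u : G u -> dot (iter n T u) w = dot u z.
    move=> Gu; rewrite adjT_iter; apply/eqP; rewrite -subr_eq0 -dotNr -dotDr.
    by rewrite (dotC0 dot (zP _ Gu)).
  exists z; split=> //; apply/eqP; rewrite -subr_eq0; apply/eqP.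
  have GZ c u : G u -> G (c *: u).
    by move=> Gu; rewrite -[_ *: _]addr0; apply: Gsub.2 => //; exact: Gsub.1.
  have GB u t : G u -> G t -> G (u - t).
    by move=> Gu Gt; rewrite addrC -scaleN1r; apply: Gsub.2.
  set d := P m z - Num.conj b *: z.
  have Gd : G d by apply: GB; [exact: GP|exact: GZ].
  apply: (dot_xx_eq0 dot); rewrite {2}/d !dotr conjCK -adjpow_sym -mulNr.
  rewrite -dotZl -dotDl scaleNr -uz ?bP//.
  by apply: GB; [exact: GP|exact: GZ].
have [z [Gz Pz uz]] := comp w0 Mw0.
have z0 : z != 0.
  by apply: contraNneq nz => z0; rewrite uz// z0 dot0r.
exists z, (Num.conj b); split=> //.
  by rewrite uz// dnorm_eq0.
move=> u Gu uz0 w Mw; have [t [Gt Pt ut]] := comp w Mw; rewrite ut//.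
have ze : dot z e != 0.
  by apply: contra_neq z0; exact: eigenvector_e (GM _ Gz) Pz.
(* the two eigenvectors z and t are proportional, by cyclicity of e *)
have tz : t = (dot t e / dot z e) *: z.
  apply/eqP; rewrite -subr_eq0; apply/eqP.
  apply: (eigenvector_e _ (Num.conj b)).
  - by apply: ME_B; [exact: GM|apply: ME_Z; exact: GM].
  - by rewrite adjpowB adjpowZ Pz Pt scalerBr !scalerA mulrC.
  - by rewrite !dotl mulfVK// subrr.
by rewrite tz dotZr uz0 mulr0.
Qed.

End FirstReturn.

(** * From recurrences to relations *)

Definition relation := exists (a b c d : R[i]) (k n : nat),
  [/\ a != 0, (0 < k)%N, (0 < n)%N &
    forall h, a *: h + b *: P k h + c *: P n h + d *: P (k + n) h = 0].

Definition recurrence (a b c d : R[i]) (k n : nat) (x : nat -> R[i]) :=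
  forall j, a * x j + b * x (k + j)%N + c * x (n + j)%N + d * x (k + n + j)%N = 0.

(** A recurrence satisfied by beta and lambda is a relation between the P_k on
    M_E that survives all shifts, hence holds everywhere; vanishing leading
    coefficients are removed by cancelling powers of T. *)
Lemma relation_of_recurrence (a b c d : R[i]) k n : (0 < k < n)%N ->
  (c != 0) || (d != 0) -> recurrence a b c d k n beta ->
  recurrence a b c d k n lambda -> relation.
Proof.
move=> /andP[k0 kn] cd0 rb rl; have n0 := ltn_trans k0 kn.
pose q (a b c d : R[i]) (k n : nat) := [:: (a, 0%N); (b, k); (c, n); (d, (k + n)%N)].
have qE a' b' c' d' k' n' j h : comb (q a' b' c' d' k' n') j h =
    a' *: P j h + b' *: P (k' + j) h + c' *: P (n' + j) h + d' *: P (k' + n' + j) h.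
  by rewrite /comb !big_cons big_nil /= addr0 !addrA.
have qrel a' b' c' d' k' n' j : a' != 0 -> (0 < k')%N -> (0 < n')%N ->
    (forall h, comb (q a' b' c' d' k' n') j h = 0) -> relation.
  move=> a0 k'0 n'0 /comb_descend qh; exists a', b', c', d', k', n'; split=> // h.
  by have := qh h; rewrite qE !addn0.
have q0 : forall h, comb (q a b c d k n) 0 h = 0.
  apply: comb_total => i; rewrite addn0 combE; last exact: ME_e.
  rewrite /betasum /lambdasum !big_cons !big_nil /= !addr0 !addrA.
  by rewrite rb rl !scale0r addr0.
have [a0|a0] := eqVneq a 0; last exact: (qrel _ _ _ _ _ _ 0%N a0 k0 n0).
have [b0|b0] := eqVneq b 0; last first.
  apply: (qrel b c 0 d (n - k)%N k k) => //; first by rewrite subn_gt0.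
  move=> h; have := q0 h; rewrite !qE a0 !scale0r add0r !addn0 addr0.
  by rewrite subnK ?(ltnW kn)// [(n + k)%N]addnC.
have [c0|c0] := eqVneq c 0; last first.
  apply: (qrel c d 0 0 k k n) => // h; have := q0 h.
  by rewrite !qE a0 b0 !scale0r !add0r !addn0 !addr0.
move: cd0; rewrite c0 eqxx /= => d0.
apply: (qrel d 0 0 0 k k (k + n)%N) => // h; have := q0 h.
by rewrite !qE a0 b0 c0 !scale0r !add0r !addn0 !addr0.
Qed.

(** Cayley-Hamilton for the n-fold shift acting on the span of beta and lambda. *)
Lemma relation_of_stable n : (0 < n)%N -> shift_stable n -> relation.
Proof.
move=> n0 st.
have nn : (0 < n < n + n)%N by rewrite n0 -addn1 leq_add2l.
apply: (relation_of_recurrence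
  (beta n * lambda (n + m)%N - lambda n * beta (n + m)%N)
  (- (beta n + lambda (n + m)%N)) 1 0 n (n + n) nn); first by rewrite oner_eq0.
- by move=> j; rewrite mul0r addr0 -addnA (st (n + j)%N).1 (st j).1 (st j).2; ring.
- by move=> j; rewrite mul0r addr0 -addnA (st (n + j)%N).2 (st j).1 (st j).2; ring.
Qed.

(** Two sequences of the plane spanned by beta and lambda whose shifts, by r and
    n > r places, stay in this plane: eliminating between the two conditions
    leaves a four-term recurrence. *)
Lemma relation_of_two_shifts r n s t s' : (0 < r < n)%N -> s != t ->
  let w := eigenvalues in w s r != 0 ->
  (forall k, w s (r + k)%N = w s r * w t k) ->
  (forall k, w s' (n + k)%N = lambda k * w s' (n + m)%N + beta k * w s' n) ->
  relation.
Proof.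
move=> rn st w wr0 wr wn.
have st0 : s - t != 0 by rewrite subr_eq0.
have lamE k : lambda k = (w s k - w t k) / (s - t).
  by rewrite /w /eigenvalues; field.
have betaE k : beta k = (s * w t k - t * w s k) / (s - t).
  by rewrite /w /eigenvalues; field.
pose c := (s' - t) / (s - t).
have w'E k : w s' k = c * w s k + (1 - c) * w t k.
  by rewrite /c /w /eigenvalues; field.
pose y := (w s' n * s - w s' (n + m)%N) / (s - t); pose x := w s' n - y.
have wnE k : w s' (n + k)%N = x * w s k + y * w t k.
  by rewrite wn /x /y lamE betaE; field.
clearbody c x y w.
have recs : recurrence x (y / w s r) (- c) (- ((1 - c) / w s r)) r n (w s).
  move=> j; have := wnE j; rewrite w'E -addnA !wr => h.
  rewrite mulrA divfK// mulNr mulNr [(1 - c) / w s r * _]mulrA divfK//.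
  by rewrite -addrA -opprD h subrr.
have rect : recurrence x (y / w s r) (- c) (- ((1 - c) / w s r)) r n (w t).
  move=> j; have tE k : w t k = w s (r + k)%N / w s r by rewrite wr mulrC mulKf.
  rewrite !tE !mulrA -!mulrDl (addnCA r n j) (_ : (r + (r + n + j) = r + n + (r + j))%N).
    by rewrite recs mul0r.
  by rewrite addnCA !addnA.
have lin z z' : recurrence x (y / w s r) (- c) (- ((1 - c) / w s r)) r n
    (fun k => z * w s k + z' * w t k).
  move=> j; have := congr2 +%R (congr1 ( *%R z) (recs j)) (congr1 ( *%R z') (rect j)).
  by rewrite !mulr0 addr0 => <-; ring.
apply: (relation_of_recurrence x (y / w s r) (- c) (- ((1 - c) / w s r)) r n rn) => [|j|j].
- rewrite !oppr_eq0 mulf_eq0 invr_eq0 (negbTE wr0) orbF.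
  by have [->|//] := eqVneq c 0; rewrite subr0 oner_eq0.
- apply: etrans (lin (- t / (s - t)) (s / (s - t)) j).
  by rewrite !betaE; field; rewrite st0.
- apply: etrans (lin ((s - t)^-1) (- (s - t)^-1) j).
  by rewrite !lamE; field; rewrite st0.
Qed.

(** * Existence of a relation *)

Lemma minimal_return (G : set H) :
  (exists n u, [/\ (0 < n)%N, G u & ~ perpM (iter n T u)]) ->
  exists n u w, [/\ (0 < n)%N, G u, M w, dot (iter n T u) w != 0 &
    forall j u, (0 < j < n)%N -> G u -> perpM (iter j T u)].
Proof.
move=> [n0 [u0 [n00 Gu0 nperp0]]].
pose A n := `[< (0 < n)%N /\ exists2 u, G u & ~ perpM (iter n T u) >].
have exA : exists n, A n by exists n0; apply/asboolP; split=> //; exists u0.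
case: (ex_minnP exA) => n /asboolP[npos [u Gu nperp]] nmin.
have [w Mw nz] : exists2 w, M w & dot (iter n T u) w != 0.
  apply: contra_notP nperp => nw w Mw; apply/eqP/negPn/negP => nz.
  by apply: nw; exists w.
exists n, u, w; split=> // j t /andP[j0 jn] Gt.
apply: contrapT => nt; have : A j by apply/asboolP; split=> //; exists t.
by move=> /nmin; rewrite leqNgt jn.
Qed.

(** Otherwise M_E is orthogonal to the range of T, hence contained in the line
    of e. *)
Lemma ME_return : exists n u, [/\ (0 < n)%N, M u & ~ perpM (iter n T u)].
Proof.
apply: contrapT => noret; have [u [Mu u0 ue _]] := dim3 e e.
case/eqP: u0; rewrite (perp_iterT u) ?ue ?scale0r// => j w Mw.
apply: (dotC0 dot); apply: contrapT => nz; apply: noret.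
by exists j.+1, w; split=> // /(_ u Mu).
Qed.

(** The case analysis on the first return of M_E, then on that of the component
    g of T^r z orthogonal to M_E, then on that of the orthocomplement G of z in
    M_E. *)
Lemma relation_exists : relation.
Proof.
have [r [u0 [w0 [r0 Mu0 Mw0 nz0 Mr]]]] := minimal_return M ME_return.
have [st|] := first_return M ME_subspace ME_closed (fun u => id)
  ME_adjpow r u0 w0 r0 Mr Mu0 Mw0 nz0; first exact: relation_of_stable st.
move=> [z [s [Mz z0 Pz nz zperp]]].
have Pkz := eigenvector_ME z s Mz Pz.
have ze : dot z e != 0 by apply: contra_neq z0; exact: eigenvector_e Mz Pz.
have zz0 : dot z z != 0 by rewrite dnorm_eq0.
have wr0 : eigenvalues s r != 0.
  apply: contra_neq z0 => w0'; apply: (adjpow_inj r).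
  by rewrite Pkz w0' scale0r.
have sreal : Num.conj s = s.
  by apply: (mulIf zz0); rewrite -dotZr -Pz -adjpow_sym Pz dotZl.
have ws k := eigenvector_defect r z (eigenvalues s) w0 r0 Pkz
  (fun j jr => Mr j z jr Mz) Mw0 nz k.
(* t is the parameter of the sequence q with w (r + k) = w r * q k *)
pose t := eigenvalues s (r + m) / eigenvalues s r.
have wst k : eigenvalues s (r + k) = eigenvalues s r * eigenvalues t k.
  by rewrite ws [eigenvalues t k]/eigenvalues /t; field.
pose y := iter r T z; pose c := dot y (P m e).
have ye : dot y e = 0 by exact: iterT_e.
have Pky k : P k y = eigenvalues t k *: y + (lambda k * c) *: e.
  have good : perp_below r z by move=> j i jr; apply: Mr => //; exact: ME_adjpow.
  have := adjpow_iterT r k z r0 good.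
  rewrite !Pkz !iterTZ adjpowZ -/y wst dotZl (adjpow_e k) dotDr !dotZr ye mulr0 add0r.
  rewrite lambda_real -/c => wPy; apply: (scalerI wr0).
  by rewrite wPy scalerDr !scalerA.
(* otherwise y is an eigenvector orthogonal to e, hence to M_E *)
have c0 : c != 0.
  apply: contraNneq nz => c0; apply/eqP.
  apply: (eigenvector_perpM y) => // k.
  by exists (eigenvalues t k); rewrite Pky c0 mulr0 scale0r addr0.
have [p [Mp yp]] := orthogonal_projection dot dotE M y ME_subspace ME_closed.
pose g := y - p.
(* M_E reduces P_k, and e lies in M_E: project the equation Pky *)
have Pkpg k : P k p = eigenvalues t k *: p + (lambda k * c) *: e /\
              P k g = eigenvalues t k *: g.
  pose d := P k p - (eigenvalues t k *: p + (lambda k * c) *: e).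
  have dg : d = eigenvalues t k *: g - P k g.
    rewrite /d /g adjpowB Pky; apply: (dot_extl dot) => x.
    by rewrite !dotl; ring.
  suff d0 : d = 0.
    split; apply/eqP; rewrite -subr_eq0; first exact/eqP.
    by rewrite -opprB -dg d0 oppr0.
  apply: perpM_ME; first by apply: ME_B; [exact: ME_adjpow|
    apply: ME_D; apply: ME_Z => //; exact: ME_e].
  move=> x Mx; rewrite dg dotDl dotNl dotZl yp// mulr0 add0r.
  by rewrite (perpM_adjpow k g yp)// oppr0.
(* for s = t, pairing P_m p with the eigenvector z gives c <e, z> = 0 *)
have st : s != t.
  apply: contra_neq ze => st; apply: (dotC0 dot); apply: (mulfI c0).
  have tE : eigenvalues t m = t by rewrite /eigenvalues beta_m lambda_m mul1r add0r.
  have := congr1 (dot^~ z) (Pkpg m).1.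
  rewrite adjpow_sym Pz dotZr sreal dotDl !dotZl tE lambda_m mul1r st => /eqP.
  by rewrite -subr_eq0 opprD addrA subrr add0r oppr_eq0 mulr0 => /eqP.
pose G := M `&` orthocompl dot [set z].
have [gret|nogret] :=
    pselect (exists n u, [/\ (0 < n)%N, [set g] u & ~ perpM (iter n T u)]).
  have [n [u [w [n0 -> Mw gw gn]]]] := minimal_return [set g] gret.
  have wt := eigenvector_defect n g (eigenvalues t) w n0 (fun k => (Pkpg k).2)
    (fun j jn => gn j g jn erefl) Mw gw.
  apply: (relation_of_two_shifts r (r + n) s t s) => //.
    by rewrite r0 -[X in (X < _)%N]addn0 ltn_add2l.
  by move=> k; rewrite -!addnA !wst wt; ring.
have [Gret|noGret] :=
    pselect (exists n u, [/\ (0 < n)%N, G u & ~ perpM (iter n T u)]).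
  have [n [u [w [n0 Gu Mw uw Gn]]]] := minimal_return G Gret.
  have rn : (r < n)%N.
    rewrite ltnNge leq_eqVlt; apply/negP => /orP[/eqP nr|nr].
      case/eqP: uw; rewrite nr; apply: zperp => //; first exact: Gu.1.
      exact: (dotC0 dot (Gu.2 z erefl)).
    by case/eqP: uw; apply: Mr => //; [rewrite n0|exact: Gu.1].
  have Gsub : is_subspace G.
    have [O0 Olin] := orthocompl_subspace dot [set z].
    split=> [|a x x' [Mx Ox] [Mx' Ox']]; first by split=> //; exact: ME_subspace.1.
    by split; [exact: ME_subspace.2|exact: Olin].
  have Gcl : closed G.
    by apply: closedI; [exact: ME_closed|exact: orthocompl_closed].
  have GP k x : G x -> G (P k x).
    move=> [Mx Ox]; split=> [|_ ->]; first exact: ME_adjpow.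
    by rewrite -adjpow_sym Pkz dotZl Ox// mulr0.
  have [st'|[z' [a [Gz' z'0 Pz' nz' _]]]] := first_return G Gsub Gcl
    (fun u => fst) GP n u w n0 Gn Gu Mw uw; first exact: relation_of_stable st'.
  have Pkz' := eigenvector_ME z' a Gz'.1 Pz'.
  apply: (relation_of_two_shifts r n s t a) => //; first by rewrite r0.
  exact: eigenvector_defect n0 Pkz' (fun j jn => Gn j z' jn Gz') Mw nz'.
(* no further return: u is orthogonal to all T^i M_E with i > 0 *)
have [u [Mu u_0 uz uy]] := dim3 z y; case/eqP: u_0.
have Gperp i x : (0 < i)%N -> G x -> perpM (iter i T x).
  by move=> i0 Gx; apply: contrapT => nx; apply: noGret; exists i, x.
have gperp i : (0 < i)%N -> perpM (iter i T g).
  by move=> i0; apply: contrapT => nx; apply: nogret; exists i, g.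
have uT i : (0 < i)%N -> forall x, M x -> dot (iter i T x) u = 0.
  elim/ltn_ind: i => i IH i0 x Mx.
  pose x' := x - (dot x z / dot z z) *: z.
  have Gx' : G x'.
    split=> [|_ ->]; first by apply: ME_B => //; exact: ME_Z.
    by apply: (dotC0 dot); rewrite /x' !dotl divfK// subrr.
  have -> : x = (dot x z / dot z z) *: z + x' by rewrite addrC subrK.
  rewrite iter_linear dotDl dotZl (Gperp i x')// addr0.
  have [ir|ri|ir] := ltngtP i r.
  - by rewrite (Mr i z) ?i0 ?mulr0.
  - rewrite -(subnK (ltnW ri)) iterD -/y (_ : y = p + g); last by rewrite addrC subrK.
    rewrite -[p]scale1r iter_linear scale1r dotDl IH ?subn_gt0//; last first.
      by rewrite ltn_subrL r0 (ltn_trans r0).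
    by rewrite gperp ?subn_gt0// addr0 mulr0.
  - by rewrite ir -/y (dotC0 dot uy) mulr0.
have := perp_iterT u (fun j x Mx => dotC0 dot (uT j.+1 (ltn0Sn j) x Mx)).
move=> uE; move: uz; rewrite uE dotZl => /eqP; rewrite mulf_eq0.
move=> /orP[/eqP ->|/eqP ez]; first by rewrite scale0r.
by case/eqP: ze; exact: (dotC0 dot).
Qed.

(** * Closed range and real coefficients *)

(** The range of T is the set of fixed points of T L, and this is an
    orthocomplement because T L has an adjoint. *)
Lemma closed_range_of_left_inverse (L L' : H -> H) :
  (forall y w, dot (L y) w = dot y (L' w)) -> (forall h, L (T h) = h) ->
  closed (range T).
Proof.
move=> LL' LT.
rewrite (_ : range T = orthocompl dot [set L' (S x) - x | x in setT]).
  exact: orthocompl_closed.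
apply/seteqP; split=> [_ [h _ <-] _ [x _ <-]|y yL].
  by apply: (dotC0 dot); rewrite dotDr dotNr -LL' LT adjT subrr.
exists (L y) => //; apply: (dot_extl dot) => x; rewrite adjT LL'.
apply/eqP; rewrite -subr_eq0 -dotNr -dotDr; apply/eqP/(dotC0 dot).
by apply: yL; exists x.
Qed.

(** Each P_i with i > 0 ends with a factor T on the right, so a relation with
    a <> 0 writes the identity as L T. *)
Lemma relation_closed_range : relation -> closed (range T).
Proof.
move=> [a [b [c [d [k [n [a0 k0 n0 rel]]]]]]].
pose L1 i y := iter i S (iter i.-1 T y).
pose L1' i y := iter i.-1 S (iter i T y).
have L1E i y w : dot (L1 i y) w = dot y (L1' i w).
  by rewrite /L1 /L1' dotC -adjT_iter -dotC adjT_iter.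
pose L y := - a^-1 *: (b *: L1 k y + c *: L1 n y + d *: L1 (k + n)%N y).
pose L' y := Num.conj (- a^-1) *: (Num.conj b *: L1' k y + Num.conj c *: L1' n y
   + Num.conj d *: L1' (k + n)%N y).
apply: (closed_range_of_left_inverse L L') => [y w|h].
  by rewrite /L /L' !dotZl !dotZr !dotDl !dotDr !dotZl !dotZr !L1E !conjCK.
have L1T i : (0 < i)%N -> L1 i (T h) = P i h.
  by case: i => // i _; rewrite /L1 /= -iterSr.
rewrite /L !L1T ?addn_gt0 ?k0//.
have /eqP := rel h; rewrite -!addrA addrC addr_eq0 !addrA => /eqP ->.
by rewrite scaleNr scalerN opprK scalerA mulVf// scale1r.
Qed.

(** The operators P_k being self-adjoint, the coefficients of a relation may be
    conjugated, hence made real. *)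
Lemma relation_real : relation -> exists (a b c d : R) (k n : nat),
  [/\ a != 0, (0 < k)%N, (0 < n)%N & star_relation dot T a b c d k n].
Proof.
move=> [a [b [c [d [k [n [a0 k0 n0 rel]]]]]]].
pose r x := complex.Re (Num.conj a * x).
have rE x : (r x)%:C%C = 2^-1 * (Num.conj a * x + a * Num.conj x).
  rewrite /r ReJ_add -[((_ * _)^*)%C]/(Num.conj (Num.conj a * x)).
  by rewrite rmorphM /= conjCK mulrC.
have relc h : Num.conj a *: h + Num.conj b *: P k h + Num.conj c *: P n h +
    Num.conj d *: P (k + n) h = 0.
  apply: (dot_extr dot) => x; rewrite !dotr !conjCK -!adjpow_sym -!dotZl -!dotDl.
  by rewrite rel dot0l.
(* after multiplication by the conjugate of a the constant term is |a|^2 *)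
exists (r a), (r b), (r c), (r d), k, n; split=> // [|h].
  rewrite -(inj_eq (@complexI R)) rE rmorph0 [a * _]mulrC -mulr2n.
  by rewrite mulf_eq0 invr_eq0 pnatr_eq0 mulrn_eq0 mulf_eq0 conjC_eq0 (negbTE a0).
rewrite !rE.
have : (2^-1 * Num.conj a) *: (a *: h + b *: P k h + c *: P n h + d *: P (k + n) h)
  + (2^-1 * a) *: (Num.conj a *: h + Num.conj b *: P k h + Num.conj c *: P n h +
    Num.conj d *: P (k + n) h) = 0 by rewrite rel relc !scaler0 addr0.
move=> <-; apply: (dot_extl dot) => x; rewrite !dotl; ring.
Qed.

End HalfCentered.

(** * The theorem *)

(** Two linear conditions on three independent vectors. *)
Lemma dim_ge3_perp {R : realType} {H : completeNormedModType R[i]}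
    (dot : {dot H for (@Num.conj R[i])}) (V : set H) :
  is_subspace V -> dim_ge 3 V ->
  forall p q, exists u, [/\ V u, u != 0, dot u p = 0 & dot u q = 0].
Proof.
move=> [V0 Vlin] [v [Vv vfree]] p q.
pose A := \matrix_(i < 3, j < 2) dot (v i) (if j == 0 then p else q).
have /rowV0Pn [x /sub_kermxP xA x0] : kermx A != 0.
  rewrite -mxrank_eq0 mxrank_ker subn_eq0 -ltnNge ltnS.
  exact: rank_leq_col.
have dotx (j : 'I_2) : dot (\sum_i x 0 i *: v i) (if j == 0 then p else q) = 0.
  have := congr1 (fun B : 'rV[R[i]]_2 => B 0 j) xA; rewrite mxE [RHS]mxE => <-.
  rewrite linear_sumlz; apply: eq_bigr => i _.
  by rewrite linearZl_LR mxE.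
exists (\sum_i x 0 i *: v i); split.
- elim/big_ind: _ => [//|a b Va Vb|i _].
    by rewrite -[a]scale1r; exact: Vlin.
  by rewrite -[_ *: v i]addr0; exact: Vlin.
- apply: contraNneq x0 => /vfree x0; apply/eqP/rowP => i.
  by rewrite x0 mxE.
- exact: (dotx 0).
- exact: (dotx 1).
Qed.

Theorem mainTheorem1 (R : realType) (H : completeNormedModType R[i])
    (dot : {dot H for (@Num.conj R[i])})
    (dotE : forall x : H, dot x x = `|x| ^+ 2)
    (T : {linear H -> H}) (Tbounded : bounded_operator T)
    (Tinj : injective T) (Thc : half_centered dot T)
    (Tspan : closed_span (\bigcup_(k in [set: nat]) (iter k T @` M_E dot T))
             = [set: H])
    (Tdim : has_dim 1 (orthocompl dot (range T))) :
  ((exists x : nat -> H,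
      [/\ orthonormal_basis dot x,
          common_eigenvectors dot T x &
          weighted_shift x T \/
          exists (J : {linear H -> H}) (n : nat) (a : R[i]),
            [/\ bounded_operator J, weighted_shift x J &
                forall y, T y = J y + a *: rank_one dot (x 0%N) (x n) y]])
   \/
   (exists (a b c d : R) (k n : nat),
      [/\ ~ [/\ a = 0, b = 0, c = 0 & d = 0], (0 < k)%N, (0 < n)%N &
          star_relation dot T a b c d k n]))
  /\
  (dim_ge 3 (M_E dot T) ->
    (exists (a b c d : R) (k n : nat),
       [/\ a != 0, (0 < k)%N, (0 < n)%N & star_relation dot T a b c d k n])
    /\ closed (range T)).
Proof.
split.
  right; exists 0, 1, (-1), 0, 1%N, 1%N; split=> // [[_ /eqP]|y].
    by rewrite oner_eq0.
  by rewrite !scale0r add0r addr0 rmorphN rmorph1 scaleN1r scale1r subrr.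
move=> dimM.
have adjT := adjointP dot dotE T Tbounded.
have dim3 := dim_ge3_perp dot _ (ME_subspace dot T) dimM.
have [v [vfree kerE]] := Tdim.
have v0 : v 0 != 0.
  apply/negP => /eqP v0; have := oner_neq0 R[i].
  by rewrite (vfree (fun=> 1) _ 0) ?eqxx// big_ord1 v0 scaler0.
have nv0 : `|v 0| != 0 by rewrite normr_eq0.
pose e := `|v 0|^-1 *: v 0.
have ee : dot e e = 1.
  rewrite /e dotZl dotZr dotE expr2.
  by rewrite conj_Creal ?mulKf ?mulVf// rpredV normr_real.
have ranT_e u : dot (T u) e = 0.
  suff /(_ (T u)) : orthocompl dot (range T) e by apply; exists u.
  by rewrite kerE; exists (fun=> `|v 0|^-1); rewrite big_ord1.
have vE : v 0 = `|v 0| *: e by rewrite /e scalerA divff// scale1r.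
clearbody e.
have ranT_perp d : (forall u, dot (T u) d = 0) -> d = dot d e *: e.
  move=> dT; have : orthocompl dot (range T) d by move=> _ [u _ <-].
  rewrite kerE => -[c]; rewrite big_ord1 vE => ->.
  by rewrite !dotZl ee mulr1 scalerA.
have [m m0] : exists m, adjpow dot T m e - alpha dot T e m *: e != 0.
  apply: contrapT => nom.
  have Pe k : adjpow dot T k e = alpha dot T e k *: e.
    by apply/eqP; rewrite -subr_eq0; apply: contrapT => /negP Pke; apply: nom; exists k.
  have [u [Mu u0 ue _]] := dim3 e e.
  case/eqP: u0; rewrite (ranT_perp u) ?ue ?scale0r// => x.
  suff /(_ (T x)) : orthocompl dot (range T) u by apply; exists x.
  apply: (ME_min dot T adjT e ranT_perp _ _ _ _ _ _ Mu).
  - exact: orthocompl_subspace.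
  - exact: orthocompl_closed.
  - move=> k y yT _ [w _ <-].
    rewrite (ranT_perp y) => [|w']; last by apply: yT; exists w'.
    by rewrite (adjpowZ dot T adjT) Pe !dotZr ranT_e !mulr0.
  - by move=> _ [w _ <-].
have rel := relation_exists dot dotE T adjT Tinj Thc e ee ranT_e ranT_perp Tspan
  m _ erefl m0 dim3.
split; first exact: relation_real rel.
exact: relation_closed_range rel.
Qed.
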